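(* Each of the eleven logics below is sound and complete for the indicated class of structures. That is, for each logic $L$ with indicated class $\mathcal{C}$, a sequent over the language of $L$ is provable in $L$ if and only if it is valid in every member of $\mathcal{C}$: \begin{itemize} \item $\mathbf{AL_i}$: bounded pocrims; \item $\mathbf{AL_c}$: involutive pocrims; \item $\mathbf{{\L}L_u}$: hoops; \item $\mathbf{{\L}L_i}$: bounded hoops; \item $\mathbf{{\L}L_c}$: bounded involutive hoops; \item $\mathbf{IL_u}$: idempotent pocrims; \item $\mathbf{IL}$: bounded idempotent pocrims; \item $\mathbf{BL}$: involutive idempotent pocrims; \item $\mathbf{CL_u}$: coops; \item $\mathbf{CL_i}$: bounded coops; \item $\mathbf{CL_c}$: involutive coops. \end{itemize}
   Context: Languages. Formulas are built from a set $\mathrm{Var}$ of propositional variables and the constants $0$ (truth) and $1$ (falsehood) using binary connectives $\otimes$ (conjunction) and $\multimap$ (implication) and a unary connective $A/2$ (halving). $A^{\perp}$ abbreviates $A\multimap 1$. The language of $\mathbf{{\L}L_u}$, $\mathbf{IL_u}$ omits $1$ and halving; that of $\mathbf{AL_i},\mathbf{AL_c},\mathbf{{\L}L_i},\mathbf{{\L}L_c},\mathbf{IL},\mathbf{BL}$ omits halving; that of $\mathbf{CL_u}$ omits $1$; that of $\mathbf{CL_i},\mathbf{CL_c}$ is the full language. A sequent $\Gamma\vdash A$ consists of a finite multiset $\Gamma$ of formulas and a formula $A$. Inference rules (the same for all the logics): from $\Gamma,A\vdash B$ infer $\Gamma\vdash A\multimap B$; from $\Gamma\vdash A$ and $\Delta\vdash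 A\multimap B$ infer $\Gamma,\Delta\vdash B$; from $\Gamma\vdash A$ and $\Delta\vdash B$ infer $\Gamma,\Delta\vdash A\otimes B$; from $\Gamma\vdash A\otimes B$ and $\Delta,A,B\vdash C$ infer $\Gamma,\Delta\vdash C$. Axiom schemata ($\Gamma$ any multiset, $A,B$ any formulas of the language): [ASM] $\Gamma,A\vdash A$; [EFQ] $\Gamma,1\vdash A$; [DNE] $\Gamma,A^{\perp\perp}\vdash A$; [CWC] $\Gamma,A\otimes(A\multimap B)\vdash B\otimes(B\multimap A)$; [CSD] $\Gamma,(A\multimap B)\multimap B\vdash(B\multimap A)\multimap A$; [CON] $\Gamma,A\vdash A\otimes A$; [HLB] $\Gamma,A/2\otimes A/2\vdash A$; [HUB] $\Gamma,A/2\multimap A\vdash A/2$. The logics, given by their axiom schemata: $\mathbf{AL_u}$ has [ASM] alone; $\mathbf{AL_i}=\mathbf{AL_u}+$[EFQ]; $\mathbf{AL_c}=\mathbf{AL_i}+$[DNE]; $\mathbf{{\L}L_u}=\mathbf{AL_u}+$[CWC]; $\mathbf{{\L}L_i}=\mathbf{{\L}L_u}+$[EFQ]; $\mathbf{{\L}L_c}=\mathbf{AL_i}+$[CSD]; $\mathbf{IL_u}=\mathbf{AL_u}+$[CON]; $\mathbf{IL}=\mathbf{AL_i}+$[CON]; $\mathbf{BL}=\mathbf{IL}+$[DNE]; $\mathbf{CL_u}=\mathbf{{\L}L_u}+$[HLB]$+$[HUB]; $\mathbf{CL_i}=\mathbf{{\L}L_i}+$[HLB]$+$[HUB]; $\mathbf{CL_c}=\mathbf{{\L}L_c}+$[HLB]$+$[HUB].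 Structures. A pocrim is a structure $(M;0,+,\rightarrow)$ with a constant $0$ and binary operations $+,\rightarrow$ such that, writing $x\ge y$ as an abbreviation for $x\rightarrow y=0$: $(x+y)+z=x+(y+z)$, $x+y=y+x$, $x+0=x$; $\ge$ is reflexive, transitive and antisymmetric; $x\ge y$ implies $x+z\ge y+z$; $x\ge 0$; and $x+y\ge z$ iff $x\ge y\rightarrow z$. A hoop is a pocrim that is naturally ordered: whenever $x\ge y$ there is $z$ with $x=y+z$. A coop is a structure $(C;0,+,\rightarrow,/2)$ whose $(0,+,\rightarrow)$-reduct is a hoop and in which $x/2=x/2\rightarrow x$ for all $x$ (here $/2$ binds tighter than $\rightarrow$). A pocrim, hoop or coop is bounded if it has a (necessarily unique) annihilator, i.e. an element $1$ with $x+1=1$ for all $x$. It is involutive if it is bounded and $\neg\neg x=x$ for all $x$, where $\neg x$ means $x\rightarrow 1$. It is idempotent if $x+x=x$ for all $x$. Semantics. An assignment $\alpha:\mathrm{Var}\to M$ into a structure extends to a map $v_\alpha$ on formulas by interpreting $0,1,\otimes,\multimap,/2$ as $0$, the annihilator $1$, $+$, $\rightarrow$, $/2$ respectively (as far as they belong to the language). $\alpha$ satisfies $C_1,\ldots,C_n\vdash A$ iff $v_\alpha(C_1)+\cdots+v_\alpha(C_n)\ge v_\alpha(A)$ (the empty sum being $0$). A sequent is valid in a structure iff it is satisfied by every assignment.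
   Formalization: No listed axiom governs the constant 0, so ⊢ 0 is valid but unprovable; the equivalence is proved for all sequents with the axiom Γ ⊢ 0 added to each logic, and for the logics exactly as listed on sequents in which 0 does not occur. *)

(* Defs.v *)
From Stdlib Require Import List Permutation.
Import ListNotations.

Set Implicit Arguments.
Unset Strict Implicit.

(** * Syntax *)

(** Every language has variables, [0], conjunction and implication; the two
    flags say whether falsehood [1] and halving are present.  Making the type
    of formulas depend on the language ensures that derivations in a logic only
    use formulas of the language of that logic. *)
Record language := Language { has_one : bool; has_half : bool }.

Inductive formula (Var : Type) (l : language) : Type :=
| Atom (p : Var)
| Zero
| One (h : has_one l = true)
| Tensor (A B : formula Var l)
| Lolli (A B : formula Var l)
| Half (h : has_half l = true) (A : formula Var l).

Arguments Atom {Var l} p.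
Arguments Zero {Var l}.
Arguments One {Var l} h.
Arguments Tensor {Var l} A B.
Arguments Lolli {Var l} A B.
Arguments Half {Var l} h A.

Declare Scope formula_scope.
Delimit Scope formula_scope with F.
Bind Scope formula_scope with formula.
Infix "⊗" := Tensor (at level 40, left associativity) : formula_scope.
Infix "⊸" := Lolli (at level 55, right associativity) : formula_scope.
Open Scope formula_scope.

Definition perp {Var l} (h : has_one l = true) (A : formula Var l) : formula Var l :=
  A ⊸ One h.

Fixpoint zero_free {Var l} (A : formula Var l) : Prop :=
  match A with
  | Atom _ | One _ => True
  | Zero => False
  | B ⊗ C | B ⊸ C => zero_free B /\ zero_free C
  | Half _ B => zero_free B
  end.

(** * Proof systems *)

Inductive schema := ASM | EFQ | DNE | CWC | CSD | CON | HLB | HUB | TRU.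

(** [instance s Γ A]: the sequent [Γ ⊢ A] is an instance of the schema [s]. *)
Inductive instance {Var l} : schema -> list (formula Var l) -> formula Var l -> Prop :=
| inst_ASM Γ A : instance ASM (A :: Γ) A
| inst_EFQ Γ h A : instance EFQ (One h :: Γ) A
| inst_DNE Γ h A : instance DNE (perp h (perp h A) :: Γ) A
| inst_CWC Γ A B : instance CWC (A ⊗ (A ⊸ B) :: Γ) (B ⊗ (B ⊸ A))
| inst_CSD Γ A B : instance CSD (((A ⊸ B) ⊸ B) :: Γ) ((B ⊸ A) ⊸ A)
| inst_CON Γ A : instance CON (A :: Γ) (A ⊗ A)
| inst_HLB Γ h A : instance HLB (Half h A ⊗ Half h A :: Γ) A
| inst_HUB Γ h A : instance HUB ((Half h A ⊸ A) :: Γ) (Half h A)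
| inst_TRU Γ : instance TRU Γ Zero.

Record logic := Logic { lang :> language; axioms : list schema }.

(** The finite multiset on the left of a sequent is a list up to permutation. *)
Inductive provable {Var} (L : logic) : list (formula Var L) -> formula Var L -> Prop :=
| prov_perm Γ Δ A : Permutation Γ Δ -> provable Γ A -> provable Δ A
| prov_axiom s Γ A : In s (axioms L) -> instance s Γ A -> provable Γ A
| prov_lolli_intro Γ A B : provable (A :: Γ) B -> provable Γ (A ⊸ B)
| prov_lolli_elim Γ Δ A B :
    provable Γ A -> provable Δ (A ⊸ B) -> provable (Γ ++ Δ) B
| prov_tensor_intro Γ Δ A B :
    provable Γ A -> provable Δ B -> provable (Γ ++ Δ) (A ⊗ B)
| prov_tensor_elim Γ Δ A B C :
    provable Γ (A ⊗ B) -> provable (A :: B :: Δ) C -> provable (Γ ++ Δ) C.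

Arguments provable {Var} L Γ A.

Definition lang_u  := Language false false.
Definition lang_i  := Language true false.
Definition lang_Cu := Language false true.
Definition lang_C  := Language true true.

Definition ALu := Logic lang_u  [ASM].
Definition ALi := Logic lang_i  (EFQ :: axioms ALu).
Definition ALc := Logic lang_i  (DNE :: axioms ALi).
Definition LLu := Logic lang_u  (CWC :: axioms ALu).
Definition LLi := Logic lang_i  (EFQ :: axioms LLu).
Definition LLc := Logic lang_i  (CSD :: axioms ALi).
Definition ILu := Logic lang_u  (CON :: axioms ALu).
Definition IL  := Logic lang_i  (CON :: axioms ALi).
Definition BL  := Logic lang_i  (DNE :: axioms IL).
Definition CLu := Logic lang_Cu (HUB :: HLB :: axioms LLu).
Definition CLi := Logic lang_C  (HUB :: HLB :: axioms LLi).
Definition CLc := Logic lang_C  (HUB :: HLB :: axioms LLc).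

(** No inference rule and no schema other than [TRU] mentions the constant [0],
    so without [TRU] it behaves like one more propositional variable; in
    particular [⊢ 0], which is valid in every pocrim, is then underivable.
    [with_truth L] adds the missing axiom [Γ ⊢ 0]. *)
Definition with_truth (L : logic) : logic := Logic L (TRU :: axioms L).

(** * Algebraic structures *)

(** Signature [(0, +, →)], together with [/2] when [b = true]. *)
Record structure (b : bool) := Structure {
  carrier :> Type;
  zero : carrier;
  plus : carrier -> carrier -> carrier;
  arr : carrier -> carrier -> carrier;
  half : b = true -> carrier -> carrier
}.

Arguments zero {b s}.
Arguments plus {b s} _ _.
Arguments arr {b s} _ _.
Arguments half {b s} _ _.

Declare Scope structure_scope.
Delimit Scope structure_scope with S.
Infix "+" := plus (at level 50, left associativity) : structure_scope.
Infix "→" := arr (at level 60, right associativity) : structure_scope.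
Notation "x ≥ y" := (arr x y = zero) (at level 70, no associativity) : structure_scope.
Open Scope structure_scope.

(** When [b = true], [pocrim] and [hoop] speak of the [(0, +, →)]-reduct. *)
Record pocrim {b} (M : structure b) : Prop := {
  plus_assoc : forall x y z : M, (x + y) + z = x + (y + z);
  plus_comm : forall x y : M, x + y = y + x;
  plus_zero : forall x : M, x + zero = x;
  ge_refl : forall x : M, x ≥ x;
  ge_trans : forall x y z : M, x ≥ y -> y ≥ z -> x ≥ z;
  ge_antisym : forall x y : M, x ≥ y -> y ≥ x -> x = y;
  ge_plus : forall x y z : M, x ≥ y -> x + z ≥ y + z;
  ge_zero : forall x : M, x ≥ zero;
  residuation : forall x y z : M, x + y ≥ z <-> x ≥ (y → z)
}.

Definition hoop {b} (M : structure b) : Prop :=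
  pocrim M /\ forall x y : M, x ≥ y -> exists z : M, x = y + z.

Definition coop (M : structure true) : Prop :=
  hoop M /\ forall x : M, half eq_refl x = (half eq_refl x → x).

Definition annihilator {b} {M : structure b} (e : M) : Prop :=
  forall x : M, x + e = e.

Definition bounded {b} (M : structure b) : Prop :=
  exists e : M, annihilator e.

Definition involutive {b} (M : structure b) : Prop :=
  exists e : M, annihilator e /\ forall x : M, ((x → e) → e) = x.

Definition idempotent {b} (M : structure b) : Prop :=
  forall x : M, x + x = x.

(** * Semantics *)

(** [e] is the interpretation of [1]. *)
Fixpoint eval {Var l} {M : structure (has_half l)} (e : M) (α : Var -> M)
    (A : formula Var l) : M :=
  match A with
  | Atom p => α p
  | Zero => zero
  | One _ => e
  | A ⊗ B => eval e α A + eval e α B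
  | A ⊸ B => eval e α A → eval e α B
  | Half h A => half h (eval e α A)
  end.

Definition satisfies {Var l} {M : structure (has_half l)} (e : M) (α : Var -> M)
    (Γ : list (formula Var l)) (A : formula Var l) : Prop :=
  fold_right plus zero (map (eval e α) Γ) ≥ eval e α A.

(** If the language contains [1] then [e] must be the annihilator of [M], which
    is unique; otherwise [e] is irrelevant, since [eval] does not depend on it. *)
Definition valid {Var l} (M : structure (has_half l))
    (Γ : list (formula Var l)) (A : formula Var l) : Prop :=
  forall e : M, (has_one l = true -> annihilator e) ->
  forall α : Var -> M, satisfies e α Γ A.

Definition valid_in {Var l} (K : structure (has_half l) -> Prop)
    (Γ : list (formula Var l)) (A : formula Var l) : Prop :=
  forall M, K M -> valid M Γ A.

(** The first clause concerns all sequents of the language and the calculus in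
    which [0] is axiomatised as truth; the second one concerns the sequents in
    which [0] does not occur, for which [TRU] is not needed. *)
Definition sound_and_complete (Var : Type) (L : logic)
    (K : structure (has_half L) -> Prop) : Prop :=
  (forall (Γ : list (formula Var L)) (A : formula Var L),
     provable (with_truth L) Γ A <-> valid_in K Γ A) /\
  (forall (Γ : list (formula Var L)) (A : formula Var L),
     Forall zero_free (A :: Γ) -> (provable L Γ A <-> valid_in K Γ A)).

Arguments sound_and_complete Var L K : clear implicits.

(* Main.v *)
Require Import Defs.
From Stdlib Require Import List Permutation Bool Eqdep_dec.
From Stdlib Require Import ClassicalEpsilon FunctionalExtensionality PropExtensionality.
From Stdlib Require Import ProofIrrelevance.
Import ListNotations.

Set Implicit Arguments.
Unset Strict Implicit.

(** Each schema is the sequent form of an inequality in the language of pocrims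
    ([law]), so soundness is an induction on derivations, and completeness is the
    construction of a Lindenbaum algebra: formulas modulo interderivability form
    a pocrim [lind] satisfying the laws of the axioms of the logic, in which
    [Γ ⊢ A] is satisfied by the canonical assignment only if it is derivable.
    This reduces each of the eleven claims to a purely algebraic one
    ([adequacy]): a structure belongs to the class in question iff it is a pocrim
    satisfying the laws of the logic.

    Three of the algebraic facts are not immediate.
    - [CWC] is equivalent to natural ordering ([natural_order_iff_cwc]): it says
      that [x + (x → y)] is symmetric in [x] and [y].
    - In a bounded pocrim, [CSD] is equivalent to being an involutive hoop
      ([law_CSD_iff]).  Taking [y] to be the annihilator in [CSD] gives double
      negation, and then contraposition turns [(x → y) → y] into the negation of
      [¬y + (¬y → ¬x)]; so [CSD] amounts to [CWC] at the negated arguments.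
    - In a hoop there is at most one [y] with [y = y → x] ([half_unique]).

    The last fact settles a point that would otherwise block the Lindenbaum
    construction: there is no rule saying that [A/2] and [B/2] are
    interderivable when [A] and [B] are.  Halving is therefore first defined on
    classes through chosen representatives.  Since the pocrim and hoop axioms do
    not mention halving, uniqueness applies to this algebra and shows that the
    choice of representatives does not matter ([lind_half_eq]).

    The Lindenbaum algebra needs a derivable [0], hence the schema [TRU].  For
    sequents without [0], replacing [0] by [A ⊸ A] throughout a derivation
    removes [TRU] again ([truth_conservative]). *)

(** * Arithmetic in pocrims and hoops *)

Section PocrimTheory.
Context {b : bool} {M : structure b} (P : pocrim M).
Implicit Types x y z : M.

Lemma zero_plus x : zero + x = x.
Proof. rewrite (plus_comm P). apply (plus_zero P). Qed.

Lemma plus_mono x y x' y' : x ≥ x' -> y ≥ y' -> x + y ≥ x' + y'.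
Proof.
  intros Hx Hy. apply (ge_trans P) with (x' + y).
  - now apply (ge_plus P).
  - rewrite (plus_comm P x' y), (plus_comm P x' y'). now apply (ge_plus P).
Qed.

Lemma plus_ge_l x y : x + y ≥ x.
Proof.
  rewrite <- (plus_zero P x) at 2. apply plus_mono; [apply (ge_refl P) | apply (ge_zero P)].
Qed.

Lemma plus_ge_r x y : x + y ≥ y.
Proof. rewrite (plus_comm P). apply plus_ge_l. Qed.

Lemma modus_ponens x y : x + (x → y) ≥ y.
Proof. rewrite (plus_comm P). apply (residuation P), (ge_refl P). Qed.

Lemma arr_weaken x y : y ≥ (x → y).
Proof. apply (residuation P), plus_ge_l. Qed.

Lemma eq_of_upper_bounds x y : (forall z, z ≥ x <-> z ≥ y) -> x = y.
Proof. intros H. apply (ge_antisym P); apply H, (ge_refl P). Qed.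

Lemma curry x y z : (x + y) → z = x → (y → z).
Proof.
  apply eq_of_upper_bounds. intros w.
  rewrite <- !(residuation P), (plus_assoc P). reflexivity.
Qed.

Lemma arr_swap x y z : x → (y → z) = y → (x → z).
Proof. rewrite <- !curry. now rewrite (plus_comm P). Qed.

Lemma zero_arr x : zero → x = x.
Proof.
  apply eq_of_upper_bounds. intros z.
  now rewrite <- (residuation P), (plus_zero P).
Qed.

Lemma annihilator_unique (e e' : M) : annihilator e -> annihilator e' -> e = e'.
Proof. intros H H'. now rewrite <- (H' e), (plus_comm P), H. Qed.

Lemma annihilator_iff_top (e : M) : annihilator e <-> forall x, e ≥ x.
Proof.
  split.
  - intros H x. rewrite <- (H x). apply plus_ge_l.
  - intros H x. apply (ge_antisym P); [apply plus_ge_r | apply H].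
Qed.

(** From left to right, [x + (x → y)] dominates [y], hence equals [y + z] for some
    [z]; this [z] dominates [y → x] because [y + z] dominates [x]. *)
Lemma natural_order_iff_cwc :
  (forall x y, x ≥ y -> exists z, x = y + z) <->
  (forall x y, x + (x → y) ≥ y + (y → x)).
Proof.
  split.
  - intros N x y.
    destruct (N _ _ (modus_ponens x y)) as [z E]. rewrite E.
    apply plus_mono; [apply (ge_refl P)|].
    apply (residuation P). rewrite (plus_comm P), <- E. apply plus_ge_l.
  - intros C x y H. exists (y → x).
    apply (ge_antisym P); [|apply modus_ponens].
    specialize (C x y). now rewrite H, (plus_zero P) in C.
Qed.

Lemma hoop_swap x y : hoop M -> x + (x → y) = y + (y → x).
Proof.
  intros [_ N]. apply (ge_antisym P); now apply natural_order_iff_cwc.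
Qed.

Lemma hoop_split x y : hoop M -> x ≥ y -> x = y + (y → x).
Proof. intros H G. now rewrite <- (hoop_swap x y H), G, (plus_zero P). Qed.

(** The two inequalities are the algebraic content of [HLB] and [HUB]. *)
Lemma halving_iff x y : y = (y → x) <-> y + y ≥ x /\ (y → x) ≥ y.
Proof.
  rewrite (residuation P). split.
  - intros E. rewrite <- E. split; apply (ge_refl P).
  - intros [H H']. now apply (ge_antisym P).
Qed.

(** Put [d = y → z].  Substituting [z → x] for [z] gives [d = (y + z) → x], which
    is symmetric, so [d = z → y] as well.  Then [d → y] and [d → z] are
    [(d + y) → x] and [(d + z) → x], which agree since [y + d = z + d] in a hoop.
    As [y] and [z] both dominate [d], they are [d + (d → y)] and [d + (d → z)]. *)
Lemma half_unique x y z : hoop M -> y = (y → x) -> z = (z → x) -> y = z.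
Proof.
  intros H Hy Hz.
  assert (D : y → z = z → y).
  { rewrite Hz at 1. rewrite arr_swap. now rewrite <- Hy. }
  assert (E : (y → z) → y = (y → z) → z).
  { rewrite Hy at 2. rewrite Hz at 3. rewrite <- !curry.
    f_equal. rewrite (plus_comm P), (hoop_swap y z H), <- D. apply (plus_comm P). }
  rewrite (hoop_split H (arr_weaken y z)), <- E.
  apply (hoop_split H). rewrite D. apply arr_weaken.
Qed.

Section Involution.
Context (e : M) (inv : forall x, (x → e) → e = x).

Lemma contraposition x y : x → y = (y → e) → (x → e).
Proof. rewrite arr_swap. now rewrite inv. Qed.

(** The right-hand side is the negation of one side of [CWC], at the negations of
    [y] and [x]. *)
Lemma double_arr x y : (x → y) → y = ((y → e) + ((y → e) → (x → e))) → e.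
Proof. now rewrite curry, arr_swap, inv, <- contraposition. Qed.

Lemma involutive_hoop_csd x y : hoop M -> (x → y) → y = (y → x) → x.
Proof. intros H. rewrite !double_arr. now rewrite hoop_swap. Qed.

Lemma csd_involutive_hoop : (forall x y, ((x → y) → y) ≥ ((y → x) → x)) -> hoop M.
Proof.
  intros C. split; [exact P|]. apply natural_order_iff_cwc. intros x y.
  rewrite <- (inv (x + (x → y))), <- (inv (y + (y → x))).
  rewrite <- (inv x), <- (inv y), <- !double_arr.
  rewrite (@ge_antisym _ _ P _ _ (C (y → e) (x → e)) (C (x → e) (y → e))).
  apply (ge_refl P).
Qed.

End Involution.

(** This is [CSD] at [y = e], since [e → x] is [zero]. *)
Lemma csd_dne (e : M) :
  (forall x, e ≥ x) -> (forall x y, ((x → y) → y) ≥ ((y → x) → x)) ->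
  forall x, ((x → e) → e) ≥ x.
Proof. intros T C x. specialize (C x e). now rewrite (T x), zero_arr in C. Qed.

Lemma involution_iff_dne (e : M) :
  (forall x, ((x → e) → e) = x) <-> (forall x, ((x → e) → e) ≥ x).
Proof.
  split; intros H x.
  - rewrite H. apply (ge_refl P).
  - apply (ge_antisym P); [apply H|]. apply (residuation P), modus_ponens.
Qed.

Lemma idempotent_iff_con : idempotent M <-> forall x, x ≥ x + x.
Proof.
  split; intros H x.
  - rewrite H. apply (ge_refl P).
  - apply (ge_antisym P); [apply plus_ge_l | apply H].
Qed.

Lemma sum_app (xs ys : list M) :
  fold_right plus zero (xs ++ ys) = fold_right plus zero xs + fold_right plus zero ys.
Proof.
  induction xs as [|x xs IH]; simpl.
  - now rewrite zero_plus.
  - now rewrite IH, (plus_assoc P).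
Qed.

Lemma sum_perm (xs ys : list M) :
  Permutation xs ys -> fold_right plus zero xs = fold_right plus zero ys.
Proof.
  induction 1; simpl; try congruence.
  rewrite <- !(plus_assoc P). f_equal. apply (plus_comm P).
Qed.

End PocrimTheory.

(** * Schemas as algebraic laws *)

(** In languages without [1] the element [e] is arbitrary, whence the guards in
    the clauses that mention it. *)
Definition law (l : language) {M : structure (has_half l)} (e : M) (s : schema) : Prop :=
  match s with
  | ASM | TRU => True
  | EFQ => has_one l = true -> forall x : M, e ≥ x
  | DNE => has_one l = true -> forall x : M, ((x → e) → e) ≥ x
  | CWC => forall x y : M, x + (x → y) ≥ y + (y → x)
  | CSD => forall x y : M, ((x → y) → y) ≥ ((y → x) → x)
  | CON => forall x : M, x ≥ x + x
  | HLB => forall h (x : M), half h x + half h x ≥ x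
  | HUB => forall h (x : M), (half h x → x) ≥ half h x
  end.

Lemma soundness Var (L : logic) (M : structure (has_half L)) (e : M) :
  pocrim M -> Forall (law e) (axioms L) ->
  forall (Γ : list (formula Var L)) A, provable L Γ A ->
  forall α, satisfies e α Γ A.
Proof.
  intros P HL Γ A D α. unfold satisfies.
  induction D as [Γ Δ A Hp D IH | s Γ A Hs HI | Γ A B D IH | Γ Δ A B D IH D' IH'
    | Γ Δ A B D IH D' IH' | Γ Δ A B C D IH D' IH']; simpl in *.
  - now rewrite <- (sum_perm P (Permutation_map (eval e α) Hp)).
  - rewrite Forall_forall in HL. specialize (HL s Hs).
    destruct HI; simpl in *;
      try (apply (ge_trans P) with (1 := plus_ge_l P _ _); auto).
    + apply (ge_refl P).
    + apply (ge_zero P).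
  - apply (residuation P). now rewrite (plus_comm P).
  - rewrite map_app, (sum_app P).
    apply (ge_trans P) with (1 := plus_mono P IH IH'). apply (modus_ponens P).
  - rewrite map_app, (sum_app P). apply (plus_mono P IH IH').
  - rewrite map_app, (sum_app P).
    apply (ge_trans P) with (2 := IH'). rewrite <- (plus_assoc P).
    apply (plus_mono P IH), (ge_refl P).
Qed.

(** * Derived rules *)

Section DerivedRules.
Context {Var : Type} {L : logic} (asm_in : In ASM (axioms L)).
Implicit Types (Γ Δ : list (formula Var L)) (A B C : formula Var L).

Lemma assumption Γ A : provable L (A :: Γ) A.
Proof. exact (prov_axiom asm_in (inst_ASM Γ A)). Qed.

Lemma weakening Γ A C : provable L Γ A -> provable L (C :: Γ) A.
Proof.
  induction 1 as [Γ Δ A Hp D IH | s Γ A Hs HI | Γ A B D IH | Γ Δ A B D IH D' IH'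
    | Γ Δ A B D IH D' IH' | Γ Δ A B E D IH D' IH'].
  - apply prov_perm with (2 := IH). now apply perm_skip.
  - destruct HI;
      try (eapply prov_perm; [apply perm_swap|]; apply prov_axiom with (1 := Hs); constructor).
    apply prov_axiom with (1 := Hs); constructor.
  - apply prov_lolli_intro. eapply prov_perm; [apply perm_swap | exact IH].
  - exact (prov_lolli_elim IH D').
  - exact (prov_tensor_intro IH D').
  - exact (prov_tensor_elim IH D').
Qed.

Lemma cut Γ Δ A B : provable L Γ A -> provable L (A :: Δ) B -> provable L (Γ ++ Δ) B.
Proof. intros H H'. exact (prov_lolli_elim H (prov_lolli_intro H')). Qed.

Lemma lolli_right Γ A B : provable L Γ (A ⊸ B) <-> provable L (A :: Γ) B.
Proof.
  split; [|apply prov_lolli_intro].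
  intros H. exact (prov_lolli_elim (assumption [] A) H).
Qed.

Lemma tensor_left Γ A B C : provable L (A ⊗ B :: Γ) C <-> provable L (A :: B :: Γ) C.
Proof.
  split; intros H.
  - exact (cut (prov_tensor_intro (assumption [] A) (assumption [] B)) H).
  - exact (prov_tensor_elim (assumption [] (A ⊗ B)) H).
Qed.

End DerivedRules.

(** * Eliminating truth *)

Fixpoint subst_zero {Var l} (T A : formula Var l) : formula Var l :=
  match A with
  | Atom p => Atom p
  | Zero => T
  | One h => One h
  | B ⊗ C => subst_zero T B ⊗ subst_zero T C
  | B ⊸ C => subst_zero T B ⊸ subst_zero T C
  | Half h B => Half h (subst_zero T B)
  end.

Lemma subst_zero_free Var l (T A : formula Var l) : zero_free A -> subst_zero T A = A.
Proof. induction A; simpl; intuition congruence. Qed.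

(** All schemata other than [TRU] are closed under substitution for [0], and
    instances of [TRU] become [Γ ⊢ T]. *)
Lemma subst_zero_provable Var (L : logic) (T : formula Var L) :
  (forall Γ, provable L Γ T) ->
  forall Γ A, provable (with_truth L) Γ A ->
  provable L (map (subst_zero T) Γ) (subst_zero T A).
Proof.
  intros HT Γ A D.
  induction D as [Γ Δ A Hp D IH | s Γ A Hs HI | Γ A B D IH | Γ Δ A B D IH D' IH'
    | Γ Δ A B D IH D' IH' | Γ Δ A B C D IH D' IH']; simpl in *; rewrite ?map_app.
  - apply prov_perm with (2 := IH). now apply Permutation_map.
  - destruct Hs as [<- | Hs].
    + inversion HI. apply HT.
    + destruct HI; simpl; try apply HT; apply prov_axiom with (1 := Hs); constructor.
  - now apply prov_lolli_intro.
  - exact (prov_lolli_elim IH IH').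
  - exact (prov_tensor_intro IH IH').
  - exact (prov_tensor_elim IH IH').
Qed.

Lemma truth_conservative Var (L : logic) (Γ : list (formula Var L)) A :
  In ASM (axioms L) -> Forall zero_free (A :: Γ) ->
  provable (with_truth L) Γ A -> provable L Γ A.
Proof.
  intros Hasm Hz D. inversion Hz as [|? ? HA HΓ]; subst.
  apply (@subst_zero_provable Var L (A ⊸ A)) in D.
  - rewrite (subst_zero_free (A ⊸ A) HA) in D.
    rewrite (map_ext_Forall _ (fun x => x)), map_id in D; [exact D|].
    revert HΓ. apply Forall_impl. intros B. apply subst_zero_free.
  - intros Δ. apply prov_lolli_intro, assumption, Hasm.
Qed.

Lemma provable_with_truth Var (L : logic) (Γ : list (formula Var L)) A :
  provable L Γ A -> provable (with_truth L) Γ A.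
Proof.
  induction 1 as [Γ Δ A Hp D IH | s Γ A Hs HI | Γ A B D IH | Γ Δ A B D IH D' IH'
    | Γ Δ A B D IH D' IH' | Γ Δ A B C D IH D' IH'].
  - exact (@prov_perm _ (with_truth L) Γ Δ A Hp IH).
  - exact (@prov_axiom _ (with_truth L) s Γ A (or_intror Hs) HI).
  - exact (@prov_lolli_intro _ (with_truth L) Γ A B IH).
  - exact (@prov_lolli_elim _ (with_truth L) Γ Δ A B IH IH').
  - exact (@prov_tensor_intro _ (with_truth L) Γ Δ A B IH IH').
  - exact (@prov_tensor_elim _ (with_truth L) Γ Δ A B C IH IH').
Qed.

(** * The Lindenbaum algebra *)

Section Lindenbaum.
Context {Var : Type} {L : logic}.
Context (asm_in : In ASM (axioms L)) (tru_in : In TRU (axioms L)).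
Implicit Types (Γ Δ : list (formula Var L)) (A B C : formula Var L).

Definition entails A B : Prop := provable L [A] B.

(** The class of [A] is represented by the set of consequences of [A], so that
    interderivable formulas have equal classes by extensionality. *)
Definition lind_carrier : Type :=
  { F : formula Var L -> Prop | exists A, F = entails A }.

Definition cls A : lind_carrier := exist _ (entails A) (ex_intro _ A eq_refl).

Definition repr (x : lind_carrier) : formula Var L :=
  proj1_sig (constructive_indefinite_description _ (proj2_sig x)).

Definition lind : structure (has_half L) := {|
  carrier := lind_carrier;
  zero := cls Zero;
  plus := fun x y => cls (repr x ⊗ repr y);
  arr := fun x y => cls (repr x ⊸ repr y);
  half := fun h x => cls (Half h (repr x))
|}.

Lemma entails_refl A : entails A A.
Proof. apply assumption, asm_in. Qed.

Lemma entails_trans A B C : entails A B -> entails B C -> entails A C.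
Proof. intros H H'. exact (cut H H'). Qed.

Lemma cls_eq A B : cls A = cls B <-> entails A B /\ entails B A.
Proof.
  split.
  - intros E. apply (f_equal (@proj1_sig _ _)) in E. simpl in E. split.
    + rewrite E. apply entails_refl.
    + rewrite <- E. apply entails_refl.
  - intros [H H']. apply subset_eq_compat. extensionality C.
    apply propositional_extensionality.
    split; intros H''; eapply entails_trans; eauto.
Qed.

Lemma cls_repr (x : lind) : cls (repr x) = x.
Proof.
  destruct x as [F HF]. apply subset_eq_compat.
  unfold repr; simpl. now destruct (constructive_indefinite_description _ HF).
Qed.

Lemma lind_ind (Q : lind -> Prop) : (forall A, Q (cls A)) -> forall x, Q x.
Proof. intros H x. rewrite <- cls_repr. apply H. Qed.

Lemma repr_cls A : entails (repr (cls A)) A /\ entails A (repr (cls A)).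
Proof. apply cls_eq, cls_repr. Qed.

Lemma tensor_mono A B A' B' :
  entails A A' -> entails B B' -> entails (A ⊗ B) (A' ⊗ B').
Proof.
  intros HA HB. apply (tensor_left asm_in). exact (prov_tensor_intro HA HB).
Qed.

Lemma lolli_mono A B A' B' :
  entails A' A -> entails B B' -> entails (A ⊸ B) (A' ⊸ B').
Proof.
  intros HA HB. apply prov_lolli_intro.
  exact (cut (prov_lolli_elim HA (entails_refl (A ⊸ B))) HB).
Qed.

Lemma cls_tensor A B : (cls A : lind) + (cls B : lind) = cls (A ⊗ B).
Proof.
  destruct (repr_cls A), (repr_cls B). apply cls_eq; split; now apply tensor_mono.
Qed.

Lemma cls_lolli A B : (cls A : lind) → (cls B : lind) = cls (A ⊸ B).
Proof.
  destruct (repr_cls A), (repr_cls B). apply cls_eq; split; now apply lolli_mono.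
Qed.

Lemma truth Γ : provable L Γ Zero.
Proof. exact (prov_axiom tru_in (inst_TRU Γ)). Qed.

Lemma cls_ge A B : (cls A : lind) ≥ (cls B : lind) <-> entails A B.
Proof.
  rewrite cls_lolli. simpl. rewrite cls_eq. split.
  - intros [_ H]. apply (lolli_right asm_in). exact (cut (truth []) H).
  - intros H. split; [apply truth|].
    apply weakening, prov_lolli_intro, H.
Qed.

Lemma lind_pocrim : pocrim lind.
Proof.
  split; repeat (refine (lind_ind _); intro).
  - rewrite !cls_tensor. apply cls_eq. split.
    + do 2 apply (tensor_left asm_in).
      apply (@prov_tensor_intro _ L [_] [_; _]); [apply entails_refl|].
      apply (@prov_tensor_intro _ L [_] [_]); apply entails_refl.
    + apply (tensor_left asm_in). eapply prov_perm; [apply perm_swap|].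
      apply (tensor_left asm_in).
      apply prov_perm with ([A; A0] ++ [A1]).
      { apply perm_trans with [A0; A; A1]; [apply perm_swap|].
        apply perm_skip, perm_swap. }
      apply prov_tensor_intro; [|apply entails_refl].
      apply (@prov_tensor_intro _ L [_] [_]); apply entails_refl.
  - rewrite !cls_tensor. apply cls_eq.
    split; apply (tensor_left asm_in); (eapply prov_perm; [apply perm_swap|]);
      apply (@prov_tensor_intro _ L [_] [_]); apply entails_refl.
  - simpl zero. rewrite cls_tensor. apply cls_eq. split.
    + apply (tensor_left asm_in), assumption, asm_in.
    + apply (@prov_tensor_intro _ L [_] []); [apply entails_refl | apply truth].
  - apply cls_ge, entails_refl.
  - rewrite !cls_ge. apply entails_trans.
  - rewrite !cls_ge, cls_eq. auto.
  - rewrite !cls_tensor, !cls_ge. intros H. apply tensor_mono; [exact H | apply entails_refl].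
  - apply (cls_ge A Zero), truth.
  - rewrite cls_tensor, (cls_lolli A0 A1), !cls_ge. unfold entails.
    rewrite (tensor_left asm_in), (lolli_right asm_in).
    split; apply prov_perm, perm_swap.
Qed.

Lemma exists_cls_one : exists e : lind, forall h, e = cls (One h).
Proof.
  destruct (bool_dec (has_one L) true) as [h|n].
  - exists (cls (One h)). intros h'. now rewrite (UIP_dec bool_dec h h').
  - exists (cls Zero). intros h. now destruct n.
Qed.

(** The laws for halving hold although [half] is defined by representatives: in
    [half h x] and [x] the same representative can be used. *)
Lemma lind_law (e : lind) s :
  (forall h, e = cls (One h)) -> In s (axioms L) -> law e s.
Proof.
  intros He Hs. destruct s; cbn [law]; trivial.
  - intros h. rewrite (He h). refine (lind_ind _); intros A.
    rewrite cls_ge. exact (prov_axiom Hs (inst_EFQ [] h A)).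
  - intros h. rewrite (He h). refine (lind_ind _); intros A.
    rewrite (cls_lolli A), cls_lolli, cls_ge. exact (prov_axiom Hs (inst_DNE [] h A)).
  - refine (lind_ind _); intros A. refine (lind_ind _); intros B.
    rewrite (cls_lolli A B), (cls_lolli B A), !cls_tensor, cls_ge.
    exact (prov_axiom Hs (inst_CWC [] A B)).
  - refine (lind_ind _); intros A. refine (lind_ind _); intros B.
    rewrite (cls_lolli A B), (cls_lolli B A).
    rewrite (cls_lolli (A ⊸ B)), (cls_lolli (B ⊸ A)), cls_ge.
    exact (prov_axiom Hs (inst_CSD [] A B)).
  - refine (lind_ind _); intros A. rewrite cls_tensor, cls_ge.
    exact (prov_axiom Hs (inst_CON [] A)).
  - intros h x.
    enough (H : forall A, (cls (Half h A) : lind) + (cls (Half h A) : lind) ≥ (cls A : lind)).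
    { specialize (H (repr x)). now rewrite cls_repr in H. }
    intros A. rewrite cls_tensor, cls_ge. exact (prov_axiom Hs (inst_HLB [] h A)).
  - intros h x.
    enough (H : forall A, ((cls (Half h A) : lind) → (cls A : lind)) ≥ (cls (Half h A) : lind)).
    { specialize (H (repr x)). now rewrite cls_repr in H. }
    intros A. rewrite cls_lolli, cls_ge. exact (prov_axiom Hs (inst_HUB [] h A)).
Qed.

(** Both sides solve [y = (y → cls A)]: the left one by the halving laws of [lind],
    the right one by the schemata at [A] itself. *)
Lemma lind_half_eq (e : lind) :
  (forall h, e = cls (One h)) ->
  (has_half L = true -> In HLB (axioms L) /\ In HUB (axioms L) /\ hoop lind) ->
  forall h A, half h (cls A : lind) = cls (Half h A).
Proof.
  intros He HH h A. destruct (HH h) as (Hl & Hu & Hh).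
  apply (half_unique lind_pocrim (x := cls A) Hh); apply (halving_iff lind_pocrim); split.
  - exact (lind_law He Hl h (cls A)).
  - exact (lind_law He Hu h (cls A)).
  - rewrite cls_tensor, cls_ge. exact (prov_axiom Hl (inst_HLB [] h A)).
  - rewrite cls_lolli, cls_ge. exact (prov_axiom Hu (inst_HUB [] h A)).
Qed.

Lemma eval_cls (e : lind) :
  (forall h, e = cls (One h)) ->
  (forall h A, half h (cls A : lind) = cls (Half h A)) ->
  forall A, eval e (fun p => cls (Atom p) : lind) A = cls A.
Proof.
  intros He HH.
  induction A as [p | | h | A IHA B IHB | A IHA B IHB | h A IHA]; cbn [eval].
  - reflexivity.
  - reflexivity.
  - apply He.
  - rewrite IHA, IHB. apply cls_tensor.
  - rewrite IHA, IHB. apply cls_lolli.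
  - rewrite IHA. apply HH.
Qed.

Lemma provable_of_satisfies (e : lind) Γ A :
  (forall B, eval e (fun p => cls (Atom p) : lind) B = cls B) ->
  satisfies e (fun p => cls (Atom p) : lind) Γ A -> provable L Γ A.
Proof.
  intros HE. unfold satisfies. rewrite HE.
  assert (HΓ : exists B, provable L Γ B /\
    fold_right plus zero (map (eval e (fun p => cls (Atom p) : lind)) Γ) = cls B).
  { induction Γ as [|C Γ (B & HB & IH)].
    - exists Zero. split; [apply truth | reflexivity].
    - exists (C ⊗ B). split.
      + exact (prov_tensor_intro (entails_refl C) HB).
      + cbn [map fold_right]. rewrite HE, IH. apply cls_tensor. }
  destruct HΓ as (B & HB & ->). rewrite cls_ge. intros H.
  rewrite <- (app_nil_r Γ). exact (cut HB H).
Qed.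

End Lindenbaum.

(** * Adequacy *)

(** The hypothesis on halving supplies what uniqueness of halves requires in the
    Lindenbaum algebra. *)
Lemma adequacy Var (L : logic) (K : structure (has_half L) -> Prop) :
  In ASM (axioms L) ->
  (has_one L = true -> In EFQ (axioms L)) ->
  (has_half L = true -> In HLB (axioms L) /\ In HUB (axioms L) /\ forall M, K M -> hoop M) ->
  (forall (M : structure (has_half L)) (e : M), (has_one L = true -> annihilator e) ->
     K M <-> pocrim M /\ Forall (law e) (axioms L)) ->
  sound_and_complete Var L K.
Proof.
  intros Hasm Hefq Hhalf HK.
  assert (Sound : forall (Γ : list (formula Var L)) A,
    provable (with_truth L) Γ A -> valid_in K Γ A).
  { intros Γ A D M HM e He α.
    destruct (proj1 (HK M e He) HM) as [P HL].
    refine (@soundness Var (with_truth L) M e P _ Γ A D α).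
    constructor; [exact I | exact HL]. }
  assert (Complete : forall (Γ : list (formula Var L)) A,
    valid_in K Γ A -> provable (with_truth L) Γ A).
  { intros Γ A V.
    assert (asm_in : In ASM (axioms (with_truth L))) by now right.
    assert (tru_in : In TRU (axioms (with_truth L))) by now left.
    destruct (@exists_cls_one Var (with_truth L)) as [e He].
    pose proof (@lind_pocrim Var _ asm_in tru_in) as P.
    assert (Hlaw : forall s, In s (axioms L) -> law (l := L) (e : @lind Var (with_truth L)) s).
    { intros s Hs. apply (lind_law asm_in tru_in He). now right. }
    assert (Hann : has_one L = true -> annihilator (e : @lind Var (with_truth L))).
    { intros h. apply (annihilator_iff_top P). exact (Hlaw EFQ (Hefq h) h). }
    assert (HM : K (@lind Var (with_truth L))).
    { apply (HK _ e Hann). split; [exact P|]. now apply Forall_forall. }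
    apply (@provable_of_satisfies Var (with_truth L) asm_in tru_in e).
    - apply eval_cls; [exact asm_in | exact He |].
      apply (lind_half_eq asm_in tru_in He).
      intros h. destruct (Hhalf h) as (Hl & Hu & Hh).
      split; [now right|]. split; [now right|]. now apply Hh.
    - apply (V _ HM e Hann). }
  split; intros Γ A.
  - split; [apply Sound | apply Complete].
  - intros Hz. split.
    + intros D. now apply Sound, provable_with_truth.
    + intros V. apply truth_conservative; auto.
Qed.

Lemma involutive_iff {b} {M : structure b} (P : pocrim M) (e : M) : annihilator e ->
  involutive M <-> forall x : M, ((x → e) → e) = x.
Proof.
  intros He. split.
  - intros (e' & He' & inv). now rewrite (annihilator_unique P He He').
  - intros inv. now exists e.
Qed.

(** Halving on structures of any signature; it is vacuous when [b = false], so that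
    the laws of all the logics can be stated uniformly. *)
Definition halving {b} (M : structure b) : Prop :=
  forall h (x : M), half h x = (half h x → x).

Section LawMeanings.
Context {l : language} {M : structure (has_half l)} (P : pocrim M) (e : M).
Context (He : has_one l = true -> annihilator e).

Lemma law_EFQ : law e EFQ.
Proof. intros h. apply (annihilator_iff_top P), He, h. Qed.

Lemma one_bounded : has_one l = true -> bounded M.
Proof. intros h. exists e. exact (He h). Qed.

Lemma law_DNE_iff : law e DNE <-> (has_one l = true -> involutive M).
Proof.
  split; intros H h.
  - now apply (involutive_iff P (He h)), (involution_iff_dne P), H.
  - now apply (involution_iff_dne P), (involutive_iff P (He h)), H.
Qed.

Lemma law_CWC_iff : law e CWC <-> hoop M.
Proof.
  split.
  - intros H. split; [exact P|]. now apply (natural_order_iff_cwc P).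
  - intros [_ N]. exact (proj1 (natural_order_iff_cwc P) N).
Qed.

Lemma law_CSD_iff : has_one l = true -> law e CSD <-> hoop M /\ involutive M.
Proof.
  intros h. rewrite (involutive_iff P (He h)). split.
  - intros C.
    assert (inv : forall x : M, ((x → e) → e) = x).
    { apply (involution_iff_dne P), (csd_dne P); [|exact C].
      now apply (annihilator_iff_top P), He. }
    split; [exact (csd_involutive_hoop P inv C) | exact inv].
  - intros [H inv] x y. rewrite (involutive_hoop_csd P inv x y H). apply (ge_refl P).
Qed.

Lemma law_CON_iff : law e CON <-> idempotent M.
Proof. symmetry. apply (idempotent_iff_con P). Qed.

Lemma law_HUB_HLB_iff : law e HUB /\ law e HLB <-> halving M.
Proof.
  split.
  - intros [Hu Hl] h x. apply (halving_iff P). split; [apply Hl | apply Hu].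
  - intros H. split; intros h x; now apply (halving_iff P).
Qed.

End LawMeanings.

Lemma coop_iff (M : structure true) : coop M <-> hoop M /\ halving M.
Proof.
  unfold coop, halving. split; intros [H Hh]; (split; [exact H|]); [|auto].
  intros h. now rewrite (UIP_dec bool_dec h eq_refl).
Qed.

Theorem theorem6 : forall Var : Type,
  sound_and_complete Var ALi (fun M => pocrim M /\ bounded M) /\
  sound_and_complete Var ALc (fun M => pocrim M /\ involutive M) /\
  sound_and_complete Var LLu (fun M => hoop M) /\
  sound_and_complete Var LLi (fun M => hoop M /\ bounded M) /\
  sound_and_complete Var LLc (fun M => hoop M /\ bounded M /\ involutive M) /\
  sound_and_complete Var ILu (fun M => pocrim M /\ idempotent M) /\
  sound_and_complete Var IL (fun M => pocrim M /\ bounded M /\ idempotent M) /\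
  sound_and_complete Var BL (fun M => pocrim M /\ involutive M /\ idempotent M) /\
  sound_and_complete Var CLu (fun M => coop M) /\
  sound_and_complete Var CLi (fun M => coop M /\ bounded M) /\
  sound_and_complete Var CLc (fun M => coop M /\ involutive M).
Proof.
  intros Var.
  repeat match goal with |- _ /\ _ => split end; apply adequacy;
    try (unfold coop; simpl; intuition (congruence || auto; fail)).
  all: intros M e He; match goal with |- context [axioms ?L] =>
    let ss := eval compute in (axioms L) in change (axioms L) with ss end;
    rewrite !Forall_cons_iff, Forall_nil_iff.
  (* [coop_iff M] is well typed only for the three logics with halving. *)
  all: try pose proof (coop_iff M).
  (* With the laws replaced by their meanings, each equivalence is an instance of
     propositional logic. *)
  all: split; intros H'; assert (P : pocrim M) by (unfold coop, hoop in H'; tauto); revert H';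
    pose proof (law_EFQ P He); pose proof (law_DNE_iff P He);
    pose proof (law_CWC_iff P e); pose proof (law_CSD_iff P He);
    pose proof (law_CON_iff P e); pose proof (law_HUB_HLB_iff P e);
    pose proof (I : law e ASM); pose proof (one_bounded He); tauto.
Qed.
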